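(* Let $k\ge1$, let $\mathbb{C}\mathbb{Z}^k$ be the group $*$-algebra of the free abelian group $\mathbb{Z}^k$ and $\varepsilon\colon\mathbb{C}\mathbb{Z}^k\to\mathbb{C}$ the linear extension of the trivial representation. Then any purely non-Gaussian cocycle on $(\mathbb{C}\mathbb{Z}^k,\varepsilon)$ admits a generating functional.
   Context: The group $*$-algebra has involution $g^*=g^{-1}$, and $\varepsilon(g)=1$ for all group elements $g$. Put $A=\mathbb{C}\mathbb{Z}^k$. A pre-Hilbert space is a complex vector space $D$ with a positive definite inner product, linear in the second argument; $L(D)$ is the $*$-algebra of adjointable linear operators $D\to D$. A cocycle on $(A,\varepsilon)$ is a linear map $\eta\colon A\to D$ with $\eta(ab)=\pi(a)\eta(b)+\eta(a)\varepsilon(b)$ for all $a,b\in A$, where $\pi\colon A\to L(D)$ is a unital $*$-representation on a pre-Hilbert space $D$. It admits a generating functional if there is a linear functional $\psi\colon A\to\mathbb{C}$ with $\psi(a^* )=\overline{\psi(a)}$ and $\varepsilon(a)\psi(b)-\psi(ab)+\psi(a)\varepsilon(b)=-\langle\eta(a^* ),\eta(b)\rangle$ for all $a,b\in A$. Given $(\pi,\eta)$, replace $D$ by the $\pi$-invariant subspace $\eta(A)$ so that $\eta$ is surjective; let $H$ be the completion of $D$, $P_G$ the orthogonal projection of $H$ onto $H_G=\{(\pi(a)-\varepsilon(a))v: a\in A, v\in D\}^\perp$, and $D_G=P_GD$. The cocycle is purely non-Gaussian if $D_G=\{0\}$. *)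

(* Defs.v *)
From HB Require Import structures.
From mathcomp Require Import all_boot all_order all_algebra finmap.
From mathcomp Require Import complex.
From mathcomp Require Import all_classical all_reals topology normedtype.
From mathcomp.multinomials Require monalg.
(* The notations of monalg and of mathcomp-analysis are incompatible. *)
Import -(notations) monalg.

Set Implicit Arguments.
Unset Strict Implicit.
Unset Printing Implicit Defensive.

Import Order.TTheory GRing.Theory Num.Theory.
Import numFieldNormedType.Exports.

Local Open Scope classical_set_scope.
Local Open Scope ring_scope.

(* The group algebra K[G] of an additively written group G: finitely supported
   functions G -> K with the convolution product. The ring structure that
   monalg puts on malg is restricted to monoids whose only unit is the neutral
   element, so only the module structure is reused. *)
Definition group_algebra (K : nzRingType) (G : zmodType) : Type := malg G K.

HB.instance Definition _ (K : nzRingType) (G : zmodType) :=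
  GRing.Lmodule.copy (group_algebra K G) (malg G K).

Section GroupAlgebra.
Context (K : nzRingType) (G : zmodType).
Implicit Types (a b c : group_algebra K G) (g h : G) (x y : K).

Definition galgU g x : group_algebra K G := mkmalgU g x.
Definition galg_elt g : group_algebra K G := galgU g 1.
Definition galg_mul a b : group_algebra K G :=
  \sum_(g <- msupp a) \sum_(h <- msupp b)
    galgU (g + h) (mcoeff g a * mcoeff h b).

Lemma galgE a : a = \sum_(g <- msupp a) galgU g (mcoeff g a).
Proof. exact: monalgE. Qed.

Lemma galg_coefU g h x : mcoeff h (galgU g x) = x *+ (g == h).
Proof. exact: mcoeffU. Qed.

Lemma galg_coefD g a b : mcoeff g (a + b) = mcoeff g a + mcoeff g b.
Proof. exact: mcoeffD. Qed.

Lemma galg_coefZ g x a : mcoeff g (x *: a) = x * mcoeff g a.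
Proof. exact: mcoeffZ. Qed.

Lemma galgU0 g : galgU g 0 = 0. Proof. exact: monalgU0. Qed.

Lemma galgUD g x y : galgU g (x + y) = galgU g x + galgU g y.
Proof. exact: monalgUD. Qed.

Lemma galgUZ g x y : galgU g (x * y) = x *: galgU g y.
Proof.
by apply/malgP => h; rewrite galg_coefZ !galg_coefU mulrnAr.
Qed.

Lemma galgU_neq0 g : galg_elt g != 0.
Proof.
apply/eqP => /(congr1 (mcoeff g)); rewrite galg_coefU eqxx mcoeff0.
by move/eqP; rewrite oner_eq0.
Qed.

Lemma galg_ind (P : group_algebra K G -> Prop) :
  P 0 -> (forall a b, P a -> P b -> P (a + b)) ->
  (forall g x, P (galgU g x)) -> forall a, P a.
Proof. by move=> P0 PD PU a; rewrite (galgE a); apply: big_ind. Qed.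

Lemma galg_mulw (d1 d2 : {fset G}) a b :
  (msupp a `<=` d1)%fset -> (msupp b `<=` d2)%fset ->
  galg_mul a b =
  \sum_(g <- d1) \sum_(h <- d2) galgU (g + h) (mcoeff g a * mcoeff h b).
Proof.
move=> le1 le2; rewrite /galg_mul (big_fset_incl _ le1) /=.
  apply: eq_bigr => g _; apply: big_fset_incl => // h _.
  by move=> /mcoeff_outdom ->; rewrite mulr0 galgU0.
move=> g _ /mcoeff_outdom ->; rewrite big1 // => h _.
by rewrite mul0r galgU0.
Qed.

Lemma galg_mulDl : left_distributive galg_mul +%R.
Proof.
move=> a b c; pose d := (msupp a `|` msupp b)%fset.
rewrite (@galg_mulw d (msupp c) (a + b)) ?msuppD_le //.
rewrite (@galg_mulw d (msupp c) a) ?fsubsetUl //.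
rewrite (@galg_mulw d (msupp c) b) ?fsubsetUr //.
rewrite -big_split /=; apply: eq_bigr => g _.
rewrite -big_split /=; apply: eq_bigr => h _.
by rewrite galg_coefD mulrDl galgUD.
Qed.

Lemma galg_mulDr : right_distributive galg_mul +%R.
Proof.
move=> a b c; pose d := (msupp b `|` msupp c)%fset.
rewrite (@galg_mulw (msupp a) d a (b + c)) ?msuppD_le //.
rewrite (@galg_mulw (msupp a) d a b) ?fsubsetUl //.
rewrite (@galg_mulw (msupp a) d a c) ?fsubsetUr //.
rewrite -big_split /=; apply: eq_bigr => g _.
rewrite -big_split /=; apply: eq_bigr => h _.
by rewrite galg_coefD mulrDr galgUD.
Qed.

Lemma galg_mul0l a : galg_mul 0 a = 0.
Proof. by rewrite /galg_mul msupp0 big_seq_fset0. Qed.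

Lemma galg_mul0r a : galg_mul a 0 = 0.
Proof.
by rewrite /galg_mul big1 // => g _; rewrite msupp0 big_seq_fset0.
Qed.

Lemma galg_mulUU g h x y :
  galg_mul (galgU g x) (galgU h y) = galgU (g + h) (x * y).
Proof.
rewrite (@galg_mulw [fset g]%fset [fset h]%fset) ?msuppU_le //.
by rewrite !big_seq_fset1 !galg_coefU !eqxx.
Qed.

Lemma galg_mulA : associative galg_mul.
Proof.
elim/galg_ind => [|a a' IHa IHa'|g x] b c; first by rewrite !galg_mul0l.
  by rewrite !galg_mulDl IHa IHa'.
elim/galg_ind: b => [|b b' IHb IHb'|h y].
- by rewrite !(galg_mul0l, galg_mul0r).
- by rewrite !(galg_mulDl, galg_mulDr) IHb IHb'.
elim/galg_ind: c => [|c c' IHc IHc'|k z]; first by rewrite !galg_mul0r.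
  by rewrite !galg_mulDr IHc IHc'.
by rewrite !galg_mulUU addrA mulrA.
Qed.

Lemma galg_mul1l : left_id (galg_elt 0) galg_mul.
Proof.
elim/galg_ind => [|a b IHa IHb|g x]; first by rewrite galg_mul0r.
  by rewrite galg_mulDr IHa IHb.
by rewrite galg_mulUU add0r mul1r.
Qed.

Lemma galg_mul1r : right_id (galg_elt 0) galg_mul.
Proof.
elim/galg_ind => [|a b IHa IHb|g x]; first by rewrite galg_mul0l.
  by rewrite galg_mulDl IHa IHb.
by rewrite galg_mulUU addr0 mulr1.
Qed.

HB.instance Definition _ := GRing.Zmodule_isNzRing.Build (group_algebra K G)
  galg_mulA galg_mul1l galg_mul1r galg_mulDl galg_mulDr (galgU_neq0 0).

Lemma galg_scalerAl x a b : x *: (a * b) = x *: a * b.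
Proof.
elim/galg_ind: a => [|a a' IHa IHa'|g y]; first by rewrite scaler0 !mul0r scaler0.
  by rewrite mulrDl !scalerDr mulrDl IHa IHa'.
elim/galg_ind: b => [|b b' IHb IHb'|h z]; first by rewrite !mulr0 scaler0.
  by rewrite !mulrDr scalerDr IHb IHb'.
have UU h1 h2 y1 y2 : galgU h1 y1 * galgU h2 y2 = galgU (h1 + h2) (y1 * y2).
  exact: galg_mulUU.
by rewrite -galgUZ !UU -galgUZ mulrA.
Qed.

HB.instance Definition _ :=
  GRing.Lmodule_isLalgebra.Build K (group_algebra K G) galg_scalerAl.

(* The augmentation: linear extension of the trivial representation g |-> 1. *)
Definition augmentation a : K := \sum_(g <- msupp a) mcoeff g a.

Lemma augmentationU g x : augmentation (galgU g x) = x.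
Proof.
rewrite /augmentation [msupp _]msuppU; case: eqP => [->|_].
  by rewrite big_seq_fset0.
by rewrite big_seq_fset1 galg_coefU eqxx.
Qed.

End GroupAlgebra.

Section GroupAlgebraCom.
Context (K : comNzRingType) (G : zmodType).

Lemma galg_mulC : commutative (@galg_mul K G).
Proof.
elim/galg_ind => [|a a' IHa IHa'|g x] b.
- by rewrite galg_mul0l galg_mul0r.
- by rewrite galg_mulDl galg_mulDr IHa IHa'.
elim/galg_ind: b => [|b b' IHb IHb'|h y]; first by rewrite galg_mul0l galg_mul0r.
  by rewrite galg_mulDl galg_mulDr IHb IHb'.
by rewrite !galg_mulUU addrC mulrC.
Qed.

HB.instance Definition _ :=
  GRing.PzRing_hasCommutativeMul.Build (group_algebra K G) galg_mulC.
HB.instance Definition _ :=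
  GRing.Lalgebra_isComAlgebra.Build K (group_algebra K G).

End GroupAlgebraCom.

(* The involution of the group *-algebra: antilinear extension of g |-> g^-1. *)
Definition galg_star (K : numClosedFieldType) (G : zmodType)
    (a : group_algebra K G) : group_algebra K G :=
  \sum_(g <- msupp a) galgU (- g) (mcoeff g a)^*.

Lemma galg_starU (K : numClosedFieldType) (G : zmodType) (g : G) (x : K) :
  galg_star (galgU g x) = galgU (- g) x^*.
Proof.
rewrite /galg_star [msupp _]msuppU; case: eqP => [->|_].
  by rewrite big_seq_fset0 conjC0 galgU0.
by rewrite big_seq_fset1 galg_coefU eqxx.
Qed.

(* A pre-Hilbert space over C is a left C-module with a form f of type
   {dot D for conjC}. The library's forms are linear in the first argument;
   [ip f] is the inner product linear in the second one. *)
Definition ip (C : numClosedFieldType) (D : lmodType C)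
    (f : {dot D for Num.conj}) (x y : D) : C := f y x.

Section PreHilbert.
Context (C : numClosedFieldType) (G : zmodType).
Context (D : lmodType C) (f : {dot D for Num.conj}).
Implicit Types (eta : {linear group_algebra C G -> D}).

Local Notation A := (group_algebra C G).

Definition is_adjoint (S T : D -> D) :=
  forall x y, ip f (S x) y = ip f x (T y).

(* Unital *-representations A -> L(D); the last clause says both that pi a is
   adjointable and that pi (a^* ) is its adjoint. *)
Record is_star_representation (pi : A -> {linear D -> D}) : Prop :=
  IsStarRepresentation {
    star_rep_linear : forall (c : C) a b x,
      pi (c *: a + b) x = c *: pi a x + pi b x;
    star_rep1 : forall x, pi 1 x = x;
    star_repM : forall a b x, pi (a * b) x = pi a (pi b x);
    star_rep_adjoint : forall a, is_adjoint (pi a) (pi (galg_star a)) }.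

Record is_cocycle (pi : A -> {linear D -> D}) eta : Prop := IsCocycle {
  cocycle_rep : is_star_representation pi;
  cocycleM : forall a b,
    eta (a * b) = pi a (eta b) + augmentation b *: eta a }.

Definition is_generating_functional eta (psi : {scalar A}) :=
  (forall a, psi (galg_star a) = (psi a)^*) /\
  (forall a b, augmentation a * psi b - psi (a * b) + psi a * augmentation b =
               - ip f (eta (galg_star a)) (eta b)).

Definition admits_generating_functional eta :=
  exists psi : {scalar A}, is_generating_functional eta psi.

End PreHilbert.

Section Hilbert.
Context (C : numClosedFieldType) (H : completeNormedModType C).
Context (g : {dot H for Num.conj}).

Definition is_hilbert := forall x : H, `|x| ^+ 2 = ip g x x.

Definition orthocomplement (S : set H) : set H :=
  [set h | forall x, S x -> ip g x h = 0].

Definition is_orthogonal_projection (V : set H) (P : H -> H) :=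
  forall x, V (P x) /\ orthocomplement V (x - P x).

(* H is a completion of the linear subspace S of D, the canonical embedding
   being the restriction of j to S (the values of j outside S are junk). *)
Record is_completion (D : lmodType C) (f : {dot D for Num.conj})
    (S : set D) (j : D -> H) : Prop := IsCompletion {
  completion_hilbert : is_hilbert;
  completion_linear : forall (c : C) x y, S x -> S y ->
    j (c *: x + y) = c *: j x + j y;
  completion_isometry : forall x y, S x -> S y -> ip g (j x) (j y) = ip f x y;
  completion_dense : dense (j @` S) }.

End Hilbert.

Section PurelyNonGaussian.
Context (C : numClosedFieldType) (G : zmodType).
Context (D : lmodType C) (f : {dot D for Num.conj}).
Context (pi : group_algebra C G -> {linear D -> D}).
Context (eta : {linear group_algebra C G -> D}).

(* The subspace H_G of a completion (H, j) of eta(A). *)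
Definition gaussian_subspace (H : completeNormedModType C)
    (g : {dot H for Num.conj}) (j : D -> H) : set H :=
  orthocomplement g
    [set j (pi a v - augmentation a *: v) | a in setT & v in range eta].

(* D is replaced by eta(A), H is the completion of eta(A), and the condition is
   P_G (eta(A)) = {0}. Completions exist and are unique up to a unitary
   compatible with the embeddings, and orthogonal projections onto closed
   subspaces exist and are unique, so the quantifier over (H, g, j, P) could
   equivalently be universal. *)
Definition purely_non_gaussian :=
  exists (H : completeNormedModType C) (g : {dot H for Num.conj})
         (j : D -> H) (P : H -> H),
    [/\ is_completion g f (range eta) j,
        is_orthogonal_projection g (gaussian_subspace g j) P &
        P @` (j @` range eta) = [set 0]].

End PurelyNonGaussian.

(* Main.v *)
Require Import Defs.
From HB Require Import structures.
From mathcomp Require Import all_boot all_order all_algebra.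
From mathcomp Require Import complex reals ring.
From mathcomp Require Import finmap all_classical topology normedtype.
From mathcomp.multinomials Require monalg.
Import -(notations) monalg.

Set Implicit Arguments.
Unset Strict Implicit.
Unset Printing Implicit Defensive.

Import Order.TTheory GRing.Theory Num.Theory.
Import numFieldNormedType.Exports.

Local Open Scope classical_set_scope.
Local Open Scope ring_scope.

(** Write U_g for pi(g) and e_g for eta(g). On group elements, the equation for
a generating functional psi says that the function
s(g, h) = <eta(-g), eta(h)> on Z^k x Z^k satisfies
psi(g + h) = psi(g) + psi(h) + s(g, h). The cocycle identity makes s a
2-cocycle of the group Z^k, so the only obstruction to finding psi is the
failure of s to be symmetric.

Symmetry is where the absence of a Gaussian part enters. Fix g and h and put
delta(a) = <eta(-g), pi(a) eta(h)> - <eta(-h), pi(a) eta(g)> for a in the group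
algebra. Commutativity gives
pi(a) eta(h) = (U_h - 1) eta(a) + epsilon(a) eta(h), and the contributions of
eta(a) to the two terms of delta(a) cancel, because
(U_(-h) - 1) eta(-g) = (U_(-g) - 1) eta(-h). Therefore
delta(a) = epsilon(a) delta(1) ([pairing_defect_augmentation]), and delta(1) = 0
follows once there are elements a with epsilon(a) = 1 for which pi(a) eta(g) and
pi(a) eta(h) are arbitrarily small.

Such elements are provided by the mean ergodic theorem in the form of Alaoglu
and Birkhoff. Call a averaging if epsilon(a) = 1 and pi(a) is a contraction;
averaging elements are closed under products and midpoints and contain the group
elements. For x in eta(A), the parallelogram law shows that the vectors pi(a) x
of almost minimal norm form a Cauchy family in the completion H, and that
they are almost fixed by every U_h. Their limit lies in H_G; it is also a limit of
vectors of eta(A), which are orthogonal to H_G when P_G vanishes on eta(A). So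
the limit is 0 and the minimal norm is 0 ([averaging_small]).

It remains that a symmetric 2-cocycle s of Z^k is a coboundary: it defines an
abelian extension of Z^k, which splits because Z^k is free
([symmetric_cocycle_coboundary]). Averaging the resulting function with its
conjugate at -g makes it hermitian, and its linear extension is the generating
functional ([generating_functional_of_coboundary]). *)

(** * Symmetric 2-cocycles and abelian extensions *)

Section SymmetricCocycle.
Context (K G : zmodType).

Record symmetric_2cocycle := Symmetric2Cocycle {
  cochain :> G -> G -> K;
  cochain0 : forall g, cochain 0 g = 0;
  cochainC : forall g h, cochain g h = cochain h g;
  cochainP : forall g h l,
    cochain g h + cochain (g + h) l = cochain h l + cochain g (h + l) }.

(** The abelian group K x G with the addition of [ext_add], which depends on the
cocycle: the name carries s so that this group structure, and not that of the
direct product, is the one found on it. *)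
Definition extension (s : symmetric_2cocycle) : Type := (K * G)%type.

Context (s : symmetric_2cocycle).

HB.instance Definition _ := Choice.on (extension s).

Definition ext_add (p q : extension s) : extension s :=
  (p.1 + q.1 + s p.2 q.2, p.2 + q.2).
Definition ext_opp (p : extension s) : extension s :=
  (- p.1 - s p.2 (- p.2), - p.2).
Definition ext_zero : extension s := (0, 0).

Lemma ext_addA : associative ext_add.
Proof.
move=> [x g] [y h] [z l]; rewrite /ext_add /=; congr (_, _); last exact: addrA.
by rewrite [x + y + _ + z]addrAC -[RHS]addrA cochainP !addrA.
Qed.

Lemma ext_addC : commutative ext_add.
Proof.
by move=> [x g] [y h]; rewrite /ext_add /= cochainC [x + y]addrC [g + h]addrC.
Qed.

Lemma ext_add0 : left_id ext_zero ext_add.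
Proof. by move=> [x g]; rewrite /ext_add /= cochain0 addr0 !add0r. Qed.

Lemma ext_addN : left_inverse ext_zero ext_opp ext_add.
Proof.
move=> [x g]; rewrite /ext_add /ext_opp /= addNr [s (- g) g]cochainC.
by rewrite addrAC subrK addNr.
Qed.

HB.instance Definition _ := GRing.isZmodule.Build (extension s)
  ext_addA ext_addC ext_add0 ext_addN.

Definition ext_proj (p : extension s) : G := p.2.

Lemma ext_proj_is_zmod_morphism : zmod_morphism ext_proj.
Proof. by []. Qed.

HB.instance Definition _ :=
  GRing.isZmodMorphism.Build (extension s) G ext_proj
    ext_proj_is_zmod_morphism.

(** The addition of the extension reads (x, g) + (y, h) =
(x + y + s(g, h), g + h), so the first coordinate of
an additive section trivializes s. *)
Lemma splitting_coboundary (sec : G -> extension s) :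
    (forall g h, sec (g + h) = sec g + sec h) ->
    (forall g, ext_proj (sec g) = g) ->
  exists phi : G -> K, forall g h, phi (g + h) = phi g + phi h + s g h.
Proof.
move=> secD secK; exists (fun g => (sec g).1) => g h.
have sD p q : (p + q : extension s).1 = p.1 + q.1 + s (ext_proj p) (ext_proj q).
  by [].
by rewrite secD sD !secK.
Qed.

End SymmetricCocycle.

Lemma row_int_basis k (g : 'rV[int]_k) :
  g = \sum_(i < k) (delta_mx 0 i : 'rV[int]_k) *~ g 0 i.
Proof.
rewrite {1}[g]row_sum_delta; apply: eq_bigr => i _.
by rewrite -[X in X *: _]intz scaler_int.
Qed.

(** Z^k is free: sending each basis vector to any of its lifts extends to an
additive section of the extension. *)
Lemma symmetric_cocycle_coboundary (K : zmodType) k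
    (s : symmetric_2cocycle K 'rV[int]_k) :
  exists phi : 'rV[int]_k -> K, forall g h, phi (g + h) = phi g + phi h + s g h.
Proof.
apply: (@splitting_coboundary _ _ s
  (fun g => \sum_(i < k) ((0, delta_mx 0 i) : extension s) *~ g 0 i)).
  move=> g h; rewrite -big_split /=; apply: eq_bigr => i _.
  by rewrite mxE mulrzDr.
move=> g; rewrite raddf_sum [RHS]row_int_basis; apply: eq_bigr => i _.
by rewrite raddfMz.
Qed.

(** * Linear extension from the group to its algebra *)

Section GroupAlgebraTheory.
Context (K : comNzRingType) (G : zmodType).
Implicit Types (a b : group_algebra K G) (g h : G).

Definition galg_extend (phi : G -> K) a : K :=
  \sum_(g <- msupp a) mcoeff g a * phi g.

Lemma galg_extendw (phi : G -> K) (d : {fset G}) a :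
  (msupp a `<=` d)%fset ->
  galg_extend phi a = \sum_(g <- d) mcoeff g a * phi g.
Proof.
move=> le; apply: big_fset_incl => // g _ /mcoeff_outdom ->.
by rewrite mul0r.
Qed.

Lemma galg_extend_is_scalar phi : scalar (galg_extend phi).
Proof.
move=> c a b; pose d := (msupp a `|` msupp b)%fset.
have led : (msupp (c *: a + b) `<=` d)%fset.
  apply: (fsubset_trans (msuppD_le _ _)); apply: fsetSU.
  exact: msuppZ_le.
rewrite (galg_extendw _ led) (@galg_extendw phi d a) ?fsubsetUl //.
rewrite (@galg_extendw phi d b) ?fsubsetUr // mulr_sumr -big_split /=.
by apply: eq_bigr => g _; rewrite galg_coefD galg_coefZ mulrDl mulrA.
Qed.

HB.instance Definition _ phi :=
  GRing.isLinear.Build K (group_algebra K G) K *%R (galg_extend phi)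
    (galg_extend_is_scalar phi).

Lemma galg_extendU phi g x : galg_extend phi (galgU g x) = x * phi g.
Proof.
rewrite (@galg_extendw _ [fset g]%fset) ?msuppU_le //.
by rewrite big_seq_fset1 galg_coefU eqxx.
Qed.

Lemma augmentationE a : augmentation a = galg_extend (fun=> 1) a.
Proof. by apply: eq_bigr => g _; rewrite mulr1. Qed.

Lemma augmentationD a b : augmentation (a + b) = augmentation a + augmentation b.
Proof. by rewrite !augmentationE linearD. Qed.

Lemma augmentationZ c a : augmentation (c *: a) = c * augmentation a.
Proof. by rewrite !augmentationE linearZ. Qed.

Lemma augmentation0 : augmentation (0 : group_algebra K G) = 0.
Proof. by rewrite augmentationE linear0. Qed.

Lemma galgU_mul g h (x y : K) :
  galgU g x * galgU h y = galgU (g + h) (x * y).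
Proof. exact: galg_mulUU. Qed.

Lemma galgU_scale g (x : K) : galgU g x = x *: galg_elt K g.
Proof. by rewrite /galg_elt -galgUZ mulr1. Qed.

Lemma augmentationM a b : augmentation (a * b) = augmentation a * augmentation b.
Proof.
elim/galg_ind: a => [|a a' IHa IHa'|g x];
  first by rewrite mul0r !augmentation0 mul0r.
  by rewrite mulrDl !augmentationD IHa IHa' mulrDl.
elim/galg_ind: b => [|b b' IHb IHb'|h y];
  first by rewrite mulr0 !augmentation0 mulr0.
  by rewrite mulrDr !augmentationD IHb IHb' mulrDr.
by rewrite galgU_mul !augmentationU.
Qed.

End GroupAlgebraTheory.

Lemma galg_starD (C : numClosedFieldType) (G : zmodType)
    (a b : group_algebra C G) : galg_star (a + b) = galg_star a + galg_star b.
Proof.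
pose d := (msupp a `|` msupp b)%fset.
have starw c : (msupp c `<=` d)%fset ->
    galg_star c = \sum_(g <- d) galgU (- g) (mcoeff g c)^*.
  move=> le; apply: big_fset_incl => // g _ /mcoeff_outdom ->.
  by rewrite conjC0 galgU0.
rewrite !starw ?msuppD_le ?fsubsetUl ?fsubsetUr // -big_split /=.
by apply: eq_bigr => g _; rewrite galg_coefD rmorphD galgUD.
Qed.

(** * Inequalities in pre-Hilbert spaces *)

Section DotTheory.
Context (C : numClosedFieldType) (D : lmodType C).
Context (f : {dot D for Num.conj}).
Implicit Types x y : D.

(** Sesquilinearity with the form applied to both arguments, in the shape in which
it is used for rewriting. *)
Lemma dotDl x y z : f (x + y) z = f x z + f y z.
Proof. exact: linearDl. Qed.
Lemma dotDr x y z : f x (y + z) = f x y + f x z.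
Proof. exact: linearDr. Qed.
Lemma dotBl x y z : f (x - y) z = f x z - f y z.
Proof. exact: linearBl. Qed.
Lemma dotBr x y z : f x (y - z) = f x y - f x z.
Proof. exact: linearBr. Qed.
Lemma dotZl a x z : f (a *: x) z = a * f x z.
Proof. exact: linearZl_LR. Qed.
Lemma dotZr a x z : f x (a *: z) = a^* * f x z.
Proof. exact: linearZr_LR. Qed.
Lemma dot0l z : f 0 z = 0.
Proof. exact: linear0l. Qed.
Lemma dot0r z : f z 0 = 0.
Proof. exact: linear0r. Qed.
Lemma dotC x y : f x y = (f y x)^*.
Proof. by rewrite hermC /= expr0 mul1r. Qed.

Lemma dot_CauchySchwarz x y : `|f x y| ^+ 2 <= f x x * f y y.
Proof.
have [->|y0] := eqVneq y 0; first by rewrite !dot0r normr0 expr0n mulr0.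
have yy : 0 < f y y by rewrite dnorm_gt0.
pose a := f x y / f y y.
have [z xE zy] : exists2 z, x = z + a *: y & f z y = 0.
  exists (x - a *: y); first by rewrite subrK.
  by rewrite dotBl dotZl /a divfK ?gt_eqF // subrr.
move: a xE => a ->; rewrite !dotDl !dotDr !dotZl !dotZr zy [f y z]dotC zy.
rewrite conjC0 !(mulr0, add0r, addr0) normrM (ger0_norm (ltW yy)) exprMn.
rewrite mulrDl [a * _]mulrA -normCK -mulrA -expr2 lerDr.
by rewrite mulr_ge0 // ?dnorm_ge0 // ltW.
Qed.

(** The parallelogram law, in the form that bounds the distance of two vectors
whose midpoint is not much shorter than they are. *)
Lemma dnorm_midpoint x y :
  f (2^-1 *: (x + y)) (2^-1 *: (x + y)) =
  2^-1 * (f x x + f y y) - 2^-1 * (2^-1 * f (x - y) (x - y)).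
Proof.
have half : 0 <= 2^-1 :> C by rewrite invr_ge0 ler0n.
rewrite !dotZl !dotZr (conj_Creal (ger0_real half)).
rewrite !dotBl !dotBr !dotDl !dotDr.
move: (f x x) (f x y) (f y x) (f y y) => p q r s.
by field.
Qed.

End DotTheory.

Lemma sqr_normD_le (C : numDomainType) (x y : C) :
  `|x + y| ^+ 2 <= 2 * (`|x| ^+ 2 + `|y| ^+ 2).
Proof.
apply: le_trans (_ : (`|x| + `|y|) ^+ 2 <= _).
  by rewrite lerXn2r ?nnegrE ?addr_ge0 // ler_normD.
rewrite -subr_ge0.
rewrite (_ : _ - _ = (`|x| - `|y|) ^+ 2); last by ring.
by rewrite real_exprn_even_ge0 ?rpredB ?normr_real.
Qed.

Lemma small_eq0 (C : numFieldType) (x M : C) :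
  0 <= x -> 0 <= M -> (forall e, 0 < e -> x <= e * M) -> x = 0.
Proof.
move=> x0 M0 small; apply/eqP; apply/negP => /negP xn0.
have xp : 0 < x by rewrite lt_def xn0.
have M1 : 0 < M + 1 by rewrite ltr_wpDl.
have := small (x / (M + 1)) (divr_gt0 xp M1).
rewrite -mulrA ler_pMr // => h.
have : (M + 1)^-1 * M < 1 by rewrite mulrC ltr_pdivrMr // mul1r ltrDl.
by move=> /(le_lt_trans h); rewrite ltxx.
Qed.

(** Completeness along a family of nested sets of vanishing diameter. Using the
filter that they generate avoids choosing a sequence, for which the complex
numbers would have to be compared with the integers. *)
Lemma nested_sets_limit (C : numClosedFieldType) (H : completeNormedModType C)
    (B : C -> set H) :
    (forall d, 0 < d -> B d !=set0) ->
    (forall d d', 0 < d -> d <= d' -> B d `<=` B d') ->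
    (forall d x y, 0 < d -> B d x -> B d y -> `|x - y| ^+ 2 < 4 * d) ->
  exists y, forall d, 0 < d -> exists2 p, B d p & `|y - p| ^+ 2 < d.
Proof.
move=> B0 Bmono Bsmall.
pose F := filter_from [set d : C | 0 < d] B.
have FF : Filter F.
  apply: filter_from_filter; first by exists 1; rewrite /= ltr01.
  move=> d d' /= d0 d'0.
  have [dd'|d'd] := real_leP (gtr0_real d0) (gtr0_real d'0).
    by exists d => // p Bp; split => //; apply: Bmono Bp.
  by exists d' => // p Bp; split => //; apply: Bmono Bp; rewrite // ltW.
have PF : ProperFilter F by apply: filter_from_proper => d /=; apply: B0.
have Fc : cauchy F.
  apply: cauchy_exP => e e0.
  have d0 : 0 < e ^+ 2 / 4 by rewrite divr_gt0 ?exprn_gt0 // ltr0n.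
  have [p Bp] := B0 _ d0; exists p, (e ^+ 2 / 4) => //= r Br.
  rewrite -ball_normE /=.
  have := Bsmall _ _ _ d0 Bp Br.
  by rewrite mulrC divfK ?pnatr_eq0 // ltr_sqr ?nnegrE // ltW.
have /cauchy_cvgP/cvg_ex[y Fy] := Fc.
exists y => d d0.
have e0 : 0 < sqrtC d by rewrite sqrtC_gt0.
have : F (ball y (sqrtC d)) by apply: Fy; apply: nbhsx_ballx.
have Fd : F (B d) by exists d.
move=> /(filterI Fd) FI.
have [p [Bp yp]] := filter_ex FI.
exists p => //; move: yp; rewrite -ball_normE /= => yp.
by rewrite -[d]sqrtCK ltr_sqr ?nnegrE // ltW.
Qed.

(** The squared norms are complex numbers with zero imaginary part, so their
infimum is taken in the reals and then embedded. *)
Lemma dnorm_infimum (R : realType) (D : lmodType R[i])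
    (f : {dot D for Num.conj}) (E : set D) :
    E !=set0 ->
  exists2 m : R[i], (forall x, E x -> m <= f x x) &
    forall d, 0 < d -> exists2 x, E x & f x x < m + d.
Proof.
move=> [x0 Ex0].
pose N (x : D) : R := complex.Re (f x x).
have NE x : f x x = (N x)%:C%C by rewrite RRe_real // ger0_real // dnorm_ge0.
have N0 x : 0 <= N x by rewrite -ler0c -NE dnorm_ge0.
pose S := [set N x | x in E].
have Slb : lbound S 0 by move=> _ [x _ <-].
have Sn : S !=set0 by exists (N x0), x0.
have Sinf : has_inf S by split => //; exists 0.
exists (inf S)%:C%C.
- by move=> x Ex; rewrite NE lecR; apply: ge_inf; [exists 0|exists x].
- move=> d d0; have dE : d = (complex.Re d)%:C%C by rewrite RRe_real ?gtr0_real.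
  have Rd0 : 0 < complex.Re d by rewrite -ltcR -dE.
  have [_ [x Ex <-] lt] := inf_adherent Rd0 Sinf.
  by exists x => //; rewrite NE dE -rmorphD /= ltcR.
Qed.

(** * Averaging elements *)

Section Cocycles.
Context (C : numClosedFieldType) (G : zmodType) (D : lmodType C).
Context (f : {dot D for Num.conj}).
Context (pi : group_algebra C G -> {linear D -> D}).

Section Representation.
Hypothesis rep : is_star_representation f pi.
Local Notation A := (group_algebra C G).
Implicit Types (a b : A) (g h : G) (x y : D).

Local Notation U g := (pi (galg_elt C g)).

Lemma repD a b x : pi (a + b) x = pi a x + pi b x.
Proof. by have := star_rep_linear rep 1 a b x; rewrite !scale1r. Qed.

Lemma rep0 x : pi 0 x = 0.
Proof. by apply: (addrI (pi 0 x)); rewrite -repD !addr0. Qed.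

Lemma repZ c a x : pi (c *: a) x = c *: pi a x.
Proof. by have := star_rep_linear rep c a 0 x; rewrite addr0 rep0 addr0. Qed.

Lemma rep_eltN g x y : f (U g x) y = f x (U (- g) y).
Proof.
have := star_rep_adjoint rep (galg_elt C (- g)) y x.
rewrite /ip /galg_elt galg_starU opprK conjC1 => e.
by rewrite -e.
Qed.

Lemma rep_eltK g x : U (- g) (U g x) = x.
Proof.
by rewrite -(star_repM rep) [_ * _]galg_mulUU addNr mulr1 (star_rep1 rep).
Qed.

Lemma rep_elt_dnorm g x : f (U g x) (U g x) = f x x.
Proof. by rewrite rep_eltN rep_eltK. Qed.

(** Convex combinations of group elements are the motivating example; the two
conditions retained here are those that the argument uses and that
products and midpoints preserve. *)
Definition averaging a :=
  augmentation a = 1 /\ forall x, f (pi a x) (pi a x) <= f x x.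

Lemma averaging_elt g : averaging (galg_elt C g).
Proof. by split=> [|x]; rewrite ?augmentationU ?rep_elt_dnorm. Qed.

Lemma averagingM a b : averaging a -> averaging b -> averaging (a * b).
Proof.
move=> [a1 ac] [b1 bc]; split; first by rewrite augmentationM a1 b1 mulr1.
by move=> x; rewrite (star_repM rep); apply: le_trans (ac _) (bc _).
Qed.

Lemma half_ge0 : 0 <= 2^-1 :> C.
Proof. by rewrite invr_ge0 ler0n. Qed.

Lemma half_mulD (x : C) : 2^-1 * (x + x) = x.
Proof. by rewrite -mulr2n -[x *+ 2]mulr_natl mulKf // pnatr_eq0. Qed.

Lemma averaging_midpoint a b :
  averaging a -> averaging b -> averaging (2^-1 *: (a + b)).
Proof.
move=> [a1 ac] [b1 bc]; split.
  by rewrite augmentationZ augmentationD a1 b1 half_mulD.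
move=> x; rewrite repZ repD dnorm_midpoint.
apply: (@le_trans _ _ (2^-1 * (f (pi a x) (pi a x) + f (pi b x) (pi b x)))).
  by rewrite gerBl !mulr_ge0 ?half_ge0 ?dnorm_ge0.
by rewrite -[leRHS]half_mulD ler_wpM2l ?half_ge0 ?lerD.
Qed.

(** By the parallelogram law, since the midpoint of two averaging elements is
again averaging and so cannot push the norm below the bound m. *)
Lemma near_minimizers x m d a b :
    (forall c, averaging c -> m <= f (pi c x) (pi c x)) ->
    averaging a -> averaging b ->
    f (pi a x) (pi a x) < m + d -> f (pi b x) (pi b x) < m + d ->
  f (pi a x - pi b x) (pi a x - pi b x) < 4 * d.
Proof.
move=> mmin aa ab da db.
have := mmin _ (averaging_midpoint aa ab).
rewrite repZ repD dnorm_midpoint lerBrDr -lerBrDl => le.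
have lt : 2^-1 * (f (pi a x) (pi a x) + f (pi b x) (pi b x)) < m + d.
  rewrite -[ltRHS]half_mulD ltr_pM2l ?invr_gt0 ?ltr0n //; exact: ltrD.
have {le lt} : 2^-1 * (2^-1 * f (pi a x - pi b x) (pi a x - pi b x)) < d.
  by apply: (le_lt_trans le); rewrite ltrBlDl.
rewrite mulrA -invfM -natrM ltr_pdivrMl ?ltr0n //.
Qed.

End Representation.

(** * The group 2-cocycle of a cocycle and its symmetry defect *)

Context (eta : {linear group_algebra C G -> D}).
Hypothesis coc : is_cocycle f pi eta.
Let rep : is_star_representation f pi := cocycle_rep coc.
Local Notation U g := (pi (galg_elt C g)).
Local Notation e g := (eta (galg_elt C g)).

Lemma cocycle1 : eta 1 = 0.
Proof.
have := cocycleM coc 1 1; rewrite mulr1 (star_rep1 rep).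
rewrite [augmentation _]augmentationU scale1r => h.
by apply: (addrI (eta 1)); rewrite -h addr0.
Qed.

Lemma cocycle_elt g h : e (g + h) = U g (e h) + e g.
Proof.
have := cocycleM coc (galg_elt C g) (galg_elt C h).
by rewrite [_ * _]galg_mulUU mulr1 augmentationU scale1r.
Qed.

Lemma cocycle_range a x : range eta x -> range eta (pi a x).
Proof.
move=> [b _ <-]; exists (a * b - augmentation b *: a) => //.
by rewrite linearB linearZ /= (cocycleM coc) addrK.
Qed.

(** Expanding eta on both orders of the product of a and h, which agree. *)
Lemma cocycle_commutator a h :
  pi a (e h) = U h (eta a) - eta a + augmentation a *: e h.
Proof.
have := cocycleM coc a (galg_elt C h).
rewrite mulrC (cocycleM coc) augmentationU scale1r => eq.
by rewrite addrAC eq addrK.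
Qed.

(** The value <eta(-g), eta(h)>; the form is linear in its first argument, which
is why the arguments appear swapped. *)
Definition cocycle_pairing g h : C := f (e h) (e (- g)).

Lemma cocycle_pairing0 g : cocycle_pairing 0 g = 0.
Proof. by rewrite /cocycle_pairing oppr0 [eta (galg_elt C 0)]cocycle1 dot0r. Qed.

Lemma cocycle_pairingP g h l :
  cocycle_pairing g h + cocycle_pairing (g + h) l =
  cocycle_pairing h l + cocycle_pairing g (h + l).
Proof.
rewrite /cocycle_pairing (cocycle_elt h l) [g + h]addrC opprD.
rewrite (cocycle_elt (- h) (- g)) dotDr dotDl (rep_eltN rep).
by rewrite addrC -addrA addrC -addrA; congr (_ + _); rewrite addrC.
Qed.

(** The antisymmetric part of the pairing with pi(a) eta in the second slot, which
is 0 when pi(a) eta is inner. *)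
Definition pairing_defect a g h : C :=
  f (pi a (e h)) (e (- g)) - f (pi a (e g)) (e (- h)).

(** Up to a multiple epsilon(a) of eta, the cocycle pi(a) eta is inner: it sends h
to (U_h - 1) eta(a). *)
Lemma pairing_defect_augmentation a g h :
  pairing_defect a g h =
  augmentation a * (cocycle_pairing g h - cocycle_pairing h g).
Proof.
rewrite /pairing_defect /cocycle_pairing !cocycle_commutator.
rewrite !(dotBl, dotDl) !dotZl !(rep_eltN rep).
(* Both sides are eta(-g-h), by the cocycle identity in the two orders. *)
have sym : U (- h) (e (- g)) + e (- h) = U (- g) (e (- h)) + e (- g).
  by rewrite -!cocycle_elt addrC.
have -> : U (- h) (e (- g)) = U (- g) (e (- h)) + e (- g) - e (- h).
  by rewrite -sym addrK.
rewrite dotBr dotDr.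
set p := f _ _; set q := f _ _; set r := f _ _.
by ring.
Qed.

End Cocycles.

(** * The mean ergodic theorem on a completion *)

Section MeanErgodic.
Context (R : realType) (G : zmodType) (D : lmodType R[i]).
Local Notation C := R[i].
Context (f : {dot D for Num.conj}).
Context (pi : group_algebra C G -> {linear D -> D}).
Context (eta : {linear group_algebra C G -> D}).
Hypothesis coc : is_cocycle f pi eta.
Let rep : is_star_representation f pi := cocycle_rep coc.
Local Notation U g := (pi (galg_elt C g)).

Section Completion.
Context (H : completeNormedModType C) (ipH : {dot H for Num.conj}) (j : D -> H).
Hypothesis compl : is_completion ipH f (range eta) j.

Lemma completion0 : j 0 = 0.
Proof.
have r0 : range eta 0 by exists 0; rewrite ?linear0.
have := completion_linear compl 1 r0 r0; rewrite !scale1r addr0 => h.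
by apply: (addrI (j 0)); rewrite addr0 -h.
Qed.

Lemma rangeB x y : range eta x -> range eta y -> range eta (x - y).
Proof. by move=> [a _ <-] [b _ <-]; exists (a - b); rewrite ?linearB. Qed.

Lemma completionB x y : range eta x -> range eta y -> j (x - y) = j x - j y.
Proof.
move=> rx ry; rewrite addrC -scaleN1r (completion_linear compl) //.
by rewrite scaleN1r addrC.
Qed.

Lemma completion_dot x y :
  range eta x -> range eta y -> ipH (j x) (j y) = f x y.
Proof. by move=> rx ry; apply: (completion_isometry compl). Qed.

Lemma completion_norm x : `|x| ^+ 2 = ipH x x.
Proof. exact: (completion_hilbert compl). Qed.

Lemma completion_dist x y : range eta x -> range eta y ->
  `|j x - j y| ^+ 2 = f (x - y) (x - y).
Proof.
move=> rx ry; rewrite completion_norm -completionB // completion_dot //;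
  exact: rangeB.
Qed.

(** The group elements span the algebra, so orthogonality to the vectors
(U_h - 1) v is enough to lie in H_G. *)
Lemma gaussian_subspace_elt y :
    (forall h v, range eta v -> ipH y (j (U h v - v)) = 0) ->
  gaussian_subspace pi eta ipH j y.
Proof.
move=> yU _ [a _ [v rv <-]]; rewrite /ip.
have rdiff b : range eta (pi b v - augmentation b *: v).
  apply: rangeB; first exact: (cocycle_range coc).
  by case: rv => c _ <-; exists (augmentation b *: c); rewrite ?linearZ.
elim/galg_ind: a => [|a b IHa IHb|h c].
- by rewrite (rep0 rep) augmentation0 scale0r subrr completion0 dot0r.
- rewrite (repD rep) augmentationD scalerDl opprD addrACA.
  rewrite -[pi a v - _]scale1r.
  by rewrite (completion_linear compl) ?scale1r ?dotDr ?IHa ?IHb ?addr0.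
rewrite galgU_scale (repZ rep) augmentationZ -scalerA -scalerBr.
rewrite -[_ *: _]addr0 (completion_linear compl) ?completion0 ?addr0.
- rewrite dotZr augmentationU scale1r yU ?mulr0 //.
- by have := rdiff (galg_elt C h).
- by exists 0; rewrite ?linear0.
Qed.

(** U_(-h) pi(a) x is as short as pi(a) x, so both are near minimizers and hence
close to each other. As U_h acts on eta(A) but not on its completion, the
invariance of the limit y is expressed by pairing y with (U_h - 1) v. *)
Lemma minimizers_limit_gaussian x m y :
    range eta x ->
    (forall a, averaging f pi a -> m <= f (pi a x) (pi a x)) ->
    (forall d, 0 < d -> exists2 a, averaging f pi a /\ f (pi a x) (pi a x) < m + d
                                 & `|y - j (pi a x)| ^+ 2 < d) ->
  gaussian_subspace pi eta ipH j y.
Proof.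
move=> rx mmin ylim; apply: gaussian_subspace_elt => h v rv.
set u := U h v - v.
have ru : range eta u by apply: rangeB => //; apply: (cocycle_range coc).
pose M := 2 * (f u u + 4 * f v v).
have M0 : 0 <= M by rewrite mulr_ge0 ?addr_ge0 ?mulr_ge0 ?dnorm_ge0 ?ler0n.
suff : `|ipH y (j u)| ^+ 2 = 0.
  by move/eqP; rewrite expf_eq0 /= normr_eq0 => /eqP.
apply: (@small_eq0 C _ M) => [||d d0]; [by rewrite exprn_ge0 | by [] |].
have [a [aa da] ya] := ylim d d0; set z := pi a x in da ya.
have rz : range eta z by apply: (cocycle_range coc).
have aha := averagingM rep (averaging_elt rep (- h)) aa.
have Uz : f (U (- h) z - z) (U (- h) z - z) < 4 * d.
  rewrite -(star_repM rep); apply: (near_minimizers rep mmin) => //.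
  by rewrite (star_repM rep) rep_elt_dnorm.
(* <(U_h - 1) v, y> is compared with the same expression for z instead of y,
   where U_h can be moved to the other side. *)
have split_y : ipH y (j u) = ipH (y - j z) (j u) + f (U (- h) z - z) v.
  rewrite dotBl completion_dot // dotBl (rep_eltN rep) opprK /u dotBr.
  by rewrite subrK.
have CS1 : `|ipH (y - j z) (j u)| ^+ 2 <= d * f u u.
  apply: le_trans (dot_CauchySchwarz _ _ _) _.
  by rewrite completion_dot // ler_wpM2r ?dnorm_ge0 // -completion_norm ltW.
have CS2 : `|f (U (- h) z - z) v| ^+ 2 <= d * (4 * f v v).
  apply: le_trans (dot_CauchySchwarz _ _ _) _.
  by rewrite mulrA [d * 4]mulrC ler_wpM2r ?dnorm_ge0 // ltW.
rewrite split_y /M mulrCA mulrDr.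
by apply: le_trans (sqr_normD_le _ _) _; rewrite ler_wpM2l ?ler0n // lerD.
Qed.

End Completion.

(** The limit y of the near minimizers lies in H_G, hence is orthogonal to all
vectors j (pi(a) x). By Pythagoras the squared distance of y to such a vector
bounds the squared norm of that vector, which therefore gets arbitrarily small. *)
Lemma averaging_small x d : purely_non_gaussian f pi eta -> range eta x ->
  0 < d -> exists2 a, averaging f pi a & f (pi a x) (pi a x) < d.
Proof.
move=> [H [ipH [j [P [compl projP P0]]]]] rx d0.
have [m [mmin minf]] : exists m : C,
  (forall a, averaging f pi a -> m <= f (pi a x) (pi a x)) /\
  (forall d, 0 < d ->
    exists2 a, averaging f pi a & f (pi a x) (pi a x) < m + d).
  pose E : set D := [set pi a x | a in averaging f pi].
  have E0 : E !=set0.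
    by exists (pi (galg_elt C 0) x), (galg_elt C 0) => //; apply: averaging_elt.
  have [m mmin minf] := dnorm_infimum f E0.
  exists m; split => //; first by move=> a aa; apply: mmin; exists a.
  by move=> e e0; have [_ [a aa <-] lt] := minf e e0; exists a.
pose B e : set H :=
  [set j (pi a x) | a in
    [set a | averaging f pi a /\ f (pi a x) (pi a x) < m + e]].
have rpi a : range eta (pi a x) by apply: (cocycle_range coc).
have [|e e' e0 ee' _ [a [aa lt] <-]||y ylim] := @nested_sets_limit _ H B.
- by move=> e e0; have [a aa lt] := minf e e0; exists (j (pi a x)), a.
- by exists a => //; split=> //; apply: lt_le_trans lt _; rewrite lerD2l.
- move=> e _ _ e0 [a [aa da] <-] [b [ab db] <-].
  by rewrite (completion_dist compl) //; apply: (near_minimizers rep mmin).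
have yV : gaussian_subspace pi eta ipH j y.
  apply: (minimizers_limit_gaussian compl rx mmin) => e e0.
  by have [_ [a aP <-] lt] := ylim e e0; exists a.
have y_orth z : range eta z -> ipH y (j z) = 0.
  move=> rz; have [_ /(_ y yV)] := projP (j z).
  have -> : P (j z) = 0.
    have : [set 0] (P (j z)) by rewrite -P0; exists (j z) => //; exists z.
    by [].
  by rewrite subr0 /ip dotC => /(congr1 Num.conj); rewrite conjCK conjC0.
have far a : f (pi a x) (pi a x) <= `|y - j (pi a x)| ^+ 2.
  rewrite (completion_norm compl) !(dotBl, dotBr) y_orth //.
  rewrite [ipH (j _) y]dotC y_orth // conjC0 sub0r subr0 opprK.
  by rewrite (completion_dot compl) // lerDr dnorm_ge0.
have [_ [a [aa _] <-] lt] := ylim d d0.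
by exists a => //; apply: le_lt_trans (far a) lt.
Qed.

(** One averaging element a makes pi(a) eta(g) small, a second one b then makes
pi(b) pi(a) eta(h) small without spoiling the first estimate, as pi(b) is a
contraction. *)
Lemma cocycle_pairingC : purely_non_gaussian f pi eta ->
  forall g h, cocycle_pairing f eta g h = cocycle_pairing f eta h g.
Proof.
move=> png g h.
pose t := cocycle_pairing f eta g h - cocycle_pairing f eta h g.
suff : `|t| ^+ 2 = 0.
  by move/eqP; rewrite expf_eq0 /= normr_eq0 subr_eq0 => /eqP.
have re k : range eta (eta (galg_elt C k)) by exists (galg_elt C k).
pose n k := f (eta (galg_elt C k)) (eta (galg_elt C k)).
have n0 k : 0 <= n k by apply: dnorm_ge0.
apply: (@small_eq0 C _ (2 * (n (- g) + n (- h)))).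
- by rewrite exprn_ge0.
- by rewrite mulr_ge0 ?ler0n ?addr_ge0.
move=> d d0.
have [a [a1 ac] ad] := averaging_small png (re g) d0.
have [b [b1 bc] bd] := averaging_small png (cocycle_range coc a (re h)) d0.
have : pairing_defect f pi eta (b * a) g h = t.
  by rewrite (pairing_defect_augmentation coc) augmentationM a1 b1 !mul1r.
rewrite /pairing_defect !(star_repM rep) => <-.
apply: le_trans (sqr_normD_le _ _) _.
rewrite normrN [leRHS]mulrCA ler_wpM2l ?ler0n // mulrDr lerD //.
  apply: le_trans (dot_CauchySchwarz _ _ _) _.
  by rewrite ler_wpM2r // ltW.
apply: le_trans (dot_CauchySchwarz _ _ _) _.
by rewrite ler_wpM2r // ltW // (le_lt_trans (bc _)).
Qed.

End MeanErgodic.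

(** * The generating functional *)

(** Symmetry of the pairing is used once more: it makes the function
g |-> conj(phi(-g)) solve the same equation as phi, so that their mean is both a
solution and hermitian. *)
Lemma generating_functional_of_coboundary (C : numClosedFieldType)
    (G : zmodType) (D : lmodType C) (f : {dot D for Num.conj})
    (eta : {linear group_algebra C G -> D}) (phi : G -> C) :
    (forall g h, cocycle_pairing f eta g h = cocycle_pairing f eta h g) ->
    (forall g h, phi (g + h) = phi g + phi h + cocycle_pairing f eta g h) ->
  admits_generating_functional f eta.
Proof.
set s := cocycle_pairing f eta => sC phiD.
have sJ g h : (s (- g) (- h))^* = s h g.
  by rewrite /s /cocycle_pairing opprK -dotC.
pose psi g := 2^-1 * (phi g + (phi (- g))^*).
have psiD g h : psi (g + h) = psi g + psi h + s g h.
  rewrite /psi opprD !phiD !rmorphD /= sJ [s h g]sC.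
  by move: (phi g) (phi h) (s g h) (_^*) (_^*) => p q r u v; field.
have psiN g : psi (- g) = (psi g)^*.
  have half : 0 <= 2^-1 :> C by rewrite invr_ge0 ler0n.
  rewrite /psi opprK rmorphM rmorphD /= conjCK (conj_Creal (ger0_real half)).
  by rewrite addrC.
have [Psi PsiU] : exists Psi : {scalar group_algebra C G},
    forall g c, Psi (galgU g c) = c * psi g.
  by exists (galg_extend psi) => g c; apply: galg_extendU.
exists Psi; split.
  move=> a; elim/galg_ind: a => [|a b IHa IHb|g c].
  - by rewrite /galg_star msupp0 big_seq_fset0 linear0 conjC0.
  - by rewrite galg_starD !linearD rmorphD IHa IHb.
  by rewrite galg_starU !PsiU rmorphM /= psiN.
move=> a b; rewrite /ip.
elim/galg_ind: a => [|a a' IHa IHa'|g c].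
- rewrite augmentation0 /galg_star msupp0 big_seq_fset0.
  by rewrite !(mul0r, linear0, dot0r) !(subr0, addr0, oppr0).
- rewrite augmentationD !mulrDl !linearD galg_starD linearD dotDr /=.
  by rewrite opprD -IHa -IHa'; ring.
elim/galg_ind: b => [|b b' IHb IHb'|h d].
- by rewrite augmentation0 !(mulr0, linear0, dot0l) !(subr0, addr0, oppr0).
- rewrite augmentationD !mulrDr !linearD dotDl /=.
  by rewrite opprD -IHb -IHb'; ring.
rewrite galgU_mul !augmentationU galg_starU !PsiU psiD.
rewrite [eta (galgU (- g) _)](_ : _ = c^* *: eta (galg_elt C (- g))); last first.
  by rewrite galgU_scale linearZ.
rewrite [eta (galgU h _)](_ : _ = d *: eta (galg_elt C h)); last first.
  by rewrite galgU_scale linearZ.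
rewrite dotZl dotZr conjCK -/(s g h).
by ring.
Qed.

Theorem proposition4p4 (R : realType) (k : nat) (hk : (1 <= k)%N)
    (D : lmodType R[i]) (f : {dot D for Num.conj})
    (pi : group_algebra R[i] 'rV[int]_k -> {linear D -> D})
    (eta : {linear group_algebra R[i] 'rV[int]_k -> D})
    (heta : is_cocycle f pi eta) (hNG : purely_non_gaussian f pi eta) :
  admits_generating_functional f eta.
Proof.
have sC := cocycle_pairingC heta hNG.
have [phi phiD] := symmetric_cocycle_coboundary
  (Symmetric2Cocycle (cocycle_pairing0 heta) sC (cocycle_pairingP heta)).
exact: generating_functional_of_coboundary sC phiD.
Qed.
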